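(* Let $U\in\mathcal{U}(n,m)$. Then the cone-volume set $C_{\mathrm{cv}}(U)\subset\mathbb{R}^m$ is path-connected.
   Context: $\mathcal{U}(n,m)$ denotes the set of all matrices $U=(u_1,\dots,u_m)$ whose columns $u_i\in\mathbb{S}^{n-1}\subset\mathbb{R}^n$ are pairwise distinct unit vectors with $\operatorname{pos}U=\mathbb{R}^n$ (every vector of $\mathbb{R}^n$ is a non-negative linear combination of the $u_i$). For $b\in\mathbb{R}^m_{\ge0}$ let $P(U,b)=\{x\in\mathbb{R}^n:\langle u_i,x\rangle\le b_i,\ 1\le i\le m\}$, $F_i(b)=P(U,b)\cap\{x:\langle u_i,x\rangle=b_i\}$ (possibly empty), and define the cone-volume vector $\gamma(U,b)=\frac1n\big(b_1\operatorname{vol}_{n-1}(F_1(b)),\dots,b_m\operatorname{vol}_{n-1}(F_m(b))\big)^\intercal\in\mathbb{R}^m_{\ge0}$, where $\operatorname{vol}_{n-1}$ is $(n-1)$-dimensional Lebesgue measure in the respective hyperplane. The cone-volume set is $C_{\mathrm{cv}}(U)=\{\gamma(U,b):b\in\mathbb{R}^m_{\ge0},\ \operatorname{vol}(P(U,b))=1\}$. *)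

(* Defs.v *)
From HB Require Import structures.
From mathcomp Require Import all_boot all_order all_algebra.
From mathcomp Require Import all_classical all_reals all_analysis.
From mathcomp Require Import ring.

Set Implicit Arguments.
Unset Strict Implicit.
Unset Printing Implicit Defensive.

Import Order.TTheory GRing.Theory Num.Theory.
Import numFieldNormedType.Exports.

Local Open Scope classical_set_scope.
Local Open Scope ring_scope.

Definition dotp (R : realType) (n : nat) (x y : 'cV[R]_n) : R :=
  \sum_(i < n) x i 0 * y i 0.

(* The Euclidean norm; the norm [`|x|] that the library puts on matrices is the
   sup norm, which induces the same topology. *)
Definition enorm (R : realType) (n : nat) (x : 'cV[R]_n) : R :=
  Num.sqrt (dotp x x).

Definition pos (R : realType) (n m : nat) (U : 'M[R]_(n, m)) : set 'cV[R]_n :=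
  [set x | exists l : 'cV[R]_m, (forall i, 0 <= l i 0) /\ x = U *m l].

(* The class U(n, m); the columns of U are the vectors u_i. *)
Definition inU (R : realType) (n m : nat) (U : 'M[R]_(n, m)) : Prop :=
  [/\ forall i : 'I_m, enorm (col i U) = 1,
      injective (fun i : 'I_m => col i U) &
      pos U = [set: 'cV[R]_n]].

(* The n-fold product of the Lebesgue measure of the real line; for n = 0 it is
   the unit mass of the one-point space. *)
Fixpoint lebesgueT (R : realType) (n : nat) : set (n.-tuple R) -> \bar R :=
  match n with
  | 0 => \d_([tuple] : 0.-tuple (measurableTypeR R))
  | n'.+1 => fun A =>
      (@lebesgue_measure R \x
        (@lebesgueT R n' : set (n'.-tuple (measurableTypeR R)) -> \bar R))%E
        [set p : measurableTypeR R * n'.-tuple (measurableTypeR R) |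
          A [tuple of p.1 :: p.2]]
  end.

Definition vol (R : realType) (n : nat) (A : set 'cV[R]_n) : \bar R :=
  lebesgueT [set t : n.-tuple R | A (\col_i tnth t i)].

(* The columns of B form an orthonormal basis of the orthogonal complement of
   the unit vector u. *)
Definition orthoframe (R : realType) (n : nat) (u : 'cV[R]_n) :
    set 'M[R]_(n, n.-1) :=
  [set B | B^T *m B = 1%:M /\ u^T *m B = 0].

Definition frame (R : realType) (n : nat) (u : 'cV[R]_n) : 'M[R]_(n, n.-1) :=
  xget 0 (orthoframe u).

Definition hyperplane (R : realType) (n : nat) (u : 'cV[R]_n) (c : R) :
    set 'cV[R]_n :=
  [set x | dotp u x = c].

(* The (n-1)-dimensional Lebesgue measure of the part of F in
   [hyperplane u c], for a unit vector u: the map y |-> c u + B y is an isometry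
   of R^(n-1) onto that hyperplane when B is in [orthoframe u], and by the
   orthogonal and translation invariance of the Lebesgue measure the value does
   not depend on the choice of B. *)
Definition hvol (R : realType) (n : nat) (u : 'cV[R]_n) (c : R)
    (F : set 'cV[R]_n) : \bar R :=
  vol [set y : 'cV[R]_n.-1 | F (c *: u + frame u *m y)].

Definition polyhedron (R : realType) (n m : nat) (U : 'M[R]_(n, m))
    (b : 'cV[R]_m) : set 'cV[R]_n :=
  [set x | forall i : 'I_m, dotp (col i U) x <= b i 0].

Definition face (R : realType) (n m : nat) (U : 'M[R]_(n, m)) (b : 'cV[R]_m)
    (i : 'I_m) : set 'cV[R]_n :=
  polyhedron U b `&` hyperplane (col i U) (b i 0).

(* When pos U = R^n the polyhedra are bounded, so that [fine] is only applied
   to finite volumes. *)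
Definition cone_volume (R : realType) (n m : nat) (U : 'M[R]_(n, m))
    (b : 'cV[R]_m) : 'cV[R]_m :=
  \col_i (n%:R^-1 *
    (b i 0 * fine (hvol (col i U) (b i 0) (face U b i)))).

Definition cone_volume_set (R : realType) (n m : nat) (U : 'M[R]_(n, m)) :
    set 'cV[R]_m :=
  [set g | exists b : 'cV[R]_m,
     [/\ forall i, 0 <= b i 0, vol (polyhedron U b) = 1%:E &
         g = cone_volume U b]].

Definition path_connected (R : realType) (T : topologicalType) (A : set T) :
    Prop :=
  forall x y, A x -> A y ->
  exists f : R -> T,
    [/\ {within `[0, 1]%classic, continuous f}, f 0 = x, f 1 = y &
        forall t, t \in `[0, 1] -> A (f t)].

Lemma frameP (R : realType) (n : nat) (u : 'cV[R]_n) :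
  (0 < n)%N -> enorm u = 1 -> orthoframe u (frame u).
Proof.
case: n u => // k u _ u1.
have uu : u^T *m u = 1%:M.
  have d1 : dotp u u = 1.
    have [d0|d0] := leP 0 (dotp u u).
      by rewrite -(sqr_sqrtr d0) [Num.sqrt _]u1 expr1n.
    by move: u1; rewrite /enorm ltr0_sqrtr// => /esym/eqP; rewrite oner_eq0.
  apply/matrixP => i j; rewrite !ord1 !mxE -[RHS]d1.
  by apply: eq_bigr => l _; rewrite mxE.
pose e : 'cV[R]_(1 + k) := col_mx 1%:M 0.
pose E : 'M[R]_(1 + k, k) := col_mx 0 1%:M.
have ee : e^T *m e = 1%:M.
  by rewrite tr_col_mx mul_row_col !trmx1 !mul1mx trmx0 mul0mx addr0.
have EE : E^T *m E = 1%:M.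
  by rewrite tr_col_mx mul_row_col !trmx1 !mul1mx trmx0 mul0mx add0r.
have eE : e^T *m E = 0.
  by rewrite tr_col_mx mul_row_col trmx0 mulmx0 mul0mx addr0.
have [H [HH He]] : exists H : 'M[R]_(1 + k), H^T *m H = 1%:M /\ H *m e = u.
  have [->|une] := eqVneq u e.
    by exists 1%:M; rewrite trmx1 !mul1mx.
  pose v : 'cV[R]_(1 + k) := e - u.
  pose c : R := (u^T *m e) 0 0.
  have ueE : u^T *m e = c%:M by rewrite [LHS]mx11_scalar.
  have euE : e^T *m u = c%:M by rewrite -[LHS]trmxK trmx_mul trmxK ueE tr_scalar_mx.
  have veE : v^T *m e = (1 - c)%:M.
    by rewrite linearB /= mulmxBl ee ueE raddfB.
  have vvE : v^T *m v = (2 * (1 - c))%:M.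
    rewrite mulmxBr veE linearB /= mulmxBl euE uu -!raddfB /=.
    by congr (_%:M); ring.
  have c1 : 1 - c != 0.
    apply: contra_neq une => c0; move: vvE; rewrite c0 mulr0 => /matrixP/(_ 0 0).
    rewrite !mxE mul0rn => /eqP; rewrite psumr_eq0 => [/allP v0|i _]; last first.
      by rewrite mxE -expr2 sqr_ge0.
    apply/esym/eqP; rewrite -subr_eq0 -/v; apply/eqP/matrixP => i j.
    have := v0 i (mem_index_enum _).
    by rewrite ord1 !mxE -expr2 sqrf_eq0 /= => /eqP.
  pose H : 'M[R]_(1 + k) := 1%:M - (1 - c)^-1 *: (v *m v^T).
  have HT : H^T = H.
    by rewrite /H linearB linearZ /= trmx1 trmx_mul trmxK.
  exists H; split; last first.
    rewrite mulmxBl mul1mx -scalemxAl -mulmxA veE mul_mx_scalar scalerA mulVf//.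
    by rewrite scale1r /v subKr.
  rewrite HT {2}/H mulmxBr mulmx1 -scalemxAr mulmxA.
  have -> : H *m v = - v.
    rewrite mulmxBl mul1mx -scalemxAl -mulmxA vvE mul_mx_scalar scalerA.
    rewrite mulrCA mulVf// mulr1 scaler_nat mulr2n opprD addrA subrr.
    by rewrite add0r.
  by rewrite mulNmx scalerN opprK subrK.
apply: (@xgetI _ _ _ (H *m E)); split.
  by rewrite trmx_mul -mulmxA [X in _ *m X]mulmxA HH mul1mx.
by rewrite -He trmx_mul -mulmxA [X in _ *m X]mulmxA HH mul1mx.
Qed.

Lemma lebesgueT0 (R : realType) (n : nat) :
  lebesgueT (set0 : set (n.-tuple R)) = 0%E.
Proof.
elim: n => [|n IHn]; first by rewrite /= diracE in_set0.
rewrite [LHS]integral0_eq// => x _ /=.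
rewrite (_ : xsection _ _ = set0) ?IHn//.
by rewrite -subset0 => y; rewrite /xsection /= inE.
Qed.

Lemma lebesgueT_box (R : realType) (n : nat) (a b : 'I_n -> R) :
  (forall i, a i <= b i) ->
  lebesgueT [set t : n.-tuple R | forall i, a i <= tnth t i <= b i] =
  (\prod_(i < n) (b i - a i))%:E.
Proof.
elim: n a b => [|n IHn] a b ab.
  by rewrite big_ord0 /= diracE mem_set// => -[].
pose J := `[a ord0, b ord0]%classic.
pose c := \prod_(i < n) (b (lift ord0 i) - a (lift ord0 i)).
transitivity (\int[@lebesgue_measure R]_x (c%:E * (\1_J x)%:E))%E.
  apply: eq_integral => x _ /=; rewrite indicE.
  have [xJ|xJ] := boolP (x \in J).
    rewrite mule1 -IHn//; congr (lebesgueT _); apply/seteqP; split => y.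
      rewrite /xsection /= inE /= => yB i.
      by have := yB (lift ord0 i); rewrite tnthS.
    move=> yB; rewrite /xsection /= inE /= => i.
    have [j ->|->] := unliftP ord0 i; first by rewrite tnthS.
    by move: xJ; rewrite inE /J /= in_itv.
  rewrite mule0 (_ : xsection _ _ = set0); first exact: lebesgueT0.
  rewrite -subset0 => y; rewrite /xsection /= inE /= => /(_ ord0) /= xab.
  by move: xJ; rewrite notin_setE /J /= in_itv.
rewrite integralZl//; last exact: integrable_indic_itv.
rewrite (integral_indic _ measurableT); last exact: measurable_itv.
have JE : lebesgue_measure J = (b ord0 - a ord0)%:E.
  rewrite /J; have := lebesgue_measure_itv (`[a ord0, b ord0] : interval R).
  move=> /= ->.
  rewrite lte_fin; have := ab ord0; rewrite le_eqVlt => /predU1P[->|->].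
    by rewrite ltxx subrr.
  by rewrite EFinB.
rewrite setIT [X in (_ * X)%E](_ : _ = (b ord0 - a ord0)%:E); last exact: JE.
by rewrite big_ord_recl -/c -EFinM mulrC.
Qed.

(* Main.v *)
(* Scaling b by s > 0 scales the volume of P(U, b) by s^n, and the volume of
   P(U, (1 - t) b + t b') is positive when those of P(U, b) and P(U, b') are.
   So the segment from b to b', rescaled pointwise to volume 1, joins b to b'
   among the admissible right-hand sides, and it remains to see that gamma(U, -)
   is continuous on b >= 0.

   Let the columns of B be an orthonormal basis of the complement of u_i. In the
   coordinates y of x = b_i u_i + B y, the face F_i(b) is the polyhedron with
   normals B^T u_j and right-hand sides b_j - b_i <u_i, u_j>.
   By dominated convergence the volume of a bounded polyhedron with nonzero
   normals depends continuously on its right-hand side, as hyperplanes are null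
   sets. The normal B^T u_j vanishes only if u_j = u_i or u_j = - u_i, and then
   the right-hand side is 0 or b_i + b_j, so that the constraint is void for
   every b >= 0. *)

From HB Require Import structures.
Require Import Defs.
From mathcomp Require Import all_boot all_order all_algebra.
From mathcomp Require Import all_classical all_reals all_analysis.
From mathcomp Require Import ring lra measurable_realfun.
Import numFieldNormedType.Exports.
Set Implicit Arguments.
Unset Strict Implicit.
Unset Printing Implicit Defensive.
Import Order.TTheory GRing.Theory Num.Theory.
Local Open Scope classical_set_scope.
Local Open Scope ring_scope.

(** * The product Lebesgue measure on tuples *)

Local Notation mtuple R n := (n.-tuple (measurableTypeR R)).

(** This is [lebesgueT] with its domain typed over [measurableTypeR R], so that the measure
    structures below can be attached to it. *)
Definition lebtuple (R : realType) (n : nat) :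
  set (mtuple R n) -> \bar R := @lebesgueT R n.

Definition consp (T : Type) (n : nat) (p : T * n.-tuple T) : n.+1.-tuple T :=
  [tuple of p.1 :: p.2].

Lemma measurable_consp (R : realType) (n : nat) :
  measurable_fun setT (@consp (measurableTypeR R) n).
Proof. exact: measurable_cons. Qed.

Lemma measurable_tbox (R : realType) (n : nat) (a b : 'I_n -> R) :
  measurable [set t : mtuple R n |
    forall i, a i <= tnth t i <= b i].
Proof.
rewrite (_ : mkset _ = \bigcap_(i in [set: 'I_n])
  ((fun t : mtuple R n => tnth t i) @^-1`
     (`[a i, b i]%classic : set (measurableTypeR R)))).
  apply: fin_bigcap_measurable => // i _.
  rewrite -[X in measurable X]setTI; apply: measurable_tnth => //.
by apply/seteqP; split => t /= h i => [_|]; [have := h i|have := h i Logic.I];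
  rewrite /= in_itv/=.
Qed.

(** The cubes with half-side k exhaust the space, and [lebesgueT_box] computes their volume directly
    from the recursion. Hence this is available before [lebtuple] is known to be a measure, as the
    induction in [lebtuple_measure] requires. *)
Lemma lebtuple_sigma_finite (R : realType) (n : nat) :
  sigma_finite setT (@lebtuple R n).
Proof.
exists (fun k => [set t | forall i, - k%:R <= tnth t i <= k%:R]).
  apply/esym; rewrite -subTset => t _.
  pose k := Num.truncn (\sum_(i < n) `|tnth t i|).
  exists k.+1 => // i.
  rewrite -ler_norml (@le_trans _ _ (\sum_(i < n) `|tnth t i|))//.
    by rewrite (bigD1 i)//= lerDl sumr_ge0.
  by rewrite ltW// truncnS_gt.
move=> k; split; first exact: measurable_tbox.
rewrite [X in (X < _)%E](@lebesgueT_box R n (fun=> - k%:R) (fun=> k%:R)) ?ltry//.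
by move=> i; rewrite (@le_trans _ _ 0)// oppr_le0.
Qed.

(* The proof is an argument so that the canonical structures can find it. *)
Definition sigma_finite_copy d (T : measurableType d) (R : realType)
  (mu : {measure set T -> \bar R}) (_ : sigma_finite setT mu) :
  set T -> \bar R := mu.

HB.instance Definition _ d (T : measurableType d) (R : realType)
  (mu : {measure set T -> \bar R}) (sf : sigma_finite setT mu) :=
  Measure.on (sigma_finite_copy sf).
HB.instance Definition _ d (T : measurableType d) (R : realType)
  (mu : {measure set T -> \bar R}) (sf : sigma_finite setT mu) :=
  Measure_isSigmaFinite.Build _ _ _ (sigma_finite_copy sf) sf.

(** In the induction step the product measure needs a sigma-finite measure as its second factor. The
    measure of the induction hypothesis is one, and [lebtuple] in dimension n + 1 is the image of
    the product under [consp]. *)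
Lemma lebtuple_measure (R : realType) (n : nat) :
  exists mu : {measure set (mtuple R n) -> \bar R},
    (mu : set _ -> \bar R) = @lebtuple R n.
Proof.
elim: n => [|n [mu muE]].
  by exists (\d_([tuple] : 0.-tuple (measurableTypeR R))).
have sf : sigma_finite setT mu by rewrite muE; exact: lebtuple_sigma_finite.
have -> : @lebtuple R n.+1 = pushforward
    (@lebesgue_measure R \x sigma_finite_copy sf)%E (@consp (measurableTypeR R) n).
  by apply/funext => A; rewrite /pushforward /= /sigma_finite_copy muE.
by exists (pushforward (@lebesgue_measure R \x sigma_finite_copy sf)%E
  (@consp (measurableTypeR R) n)).
Unshelve.
exact: measurable_consp.
Qed.

Lemma lebtuple0 (R : realType) (n : nat) : @lebtuple R n set0 = 0%E.
Proof. by have [mu <-] := lebtuple_measure R n. Qed.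

Lemma lebtuple_ge0 (R : realType) (n : nat) A : (0 <= @lebtuple R n A)%E.
Proof. by have [mu <-] := lebtuple_measure R n. Qed.

Lemma lebtuple_sigma_additive (R : realType) (n : nat) :
  semi_sigma_additive (@lebtuple R n).
Proof.
have [mu <-] := lebtuple_measure R n; exact: measure_semi_sigma_additive.
Qed.

HB.instance Definition _ (R : realType) (n : nat) :=
  isMeasure.Build _ _ _ (@lebtuple R n) (@lebtuple0 R n) (@lebtuple_ge0 R n)
    (@lebtuple_sigma_additive R n).
HB.instance Definition _ (R : realType) (n : nat) :=
  Measure_isSigmaFinite.Build _ _ _ (@lebtuple R n) (@lebtuple_sigma_finite R n).

Lemma lebtupleS (R : realType) (n : nat) (A : set (mtuple R n.+1)) :
  lebtuple A = (\int[@lebesgue_measure R]_x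
    lebtuple [set t : mtuple R n | A (consp (x, t))])%E.
Proof.
apply: eq_integral => x _ /=; congr (lebtuple _).
by apply/seteqP; split => t; rewrite /xsection /= inE.
Qed.

Lemma measurable_lebtuple_section (R : realType) (n : nat)
   (A : set (mtuple R n.+1)) : measurable A ->
  measurable_fun [set: measurableTypeR R]
    ((fun x => lebtuple [set t : mtuple R n | A (consp (x, t))])
      : measurableTypeR R -> \bar R).
Proof.
move=> mA; rewrite (_ : (fun x => _) =
    @lebtuple R n \o xsection (@consp (measurableTypeR R) n @^-1` A)).
  apply: measurable_fun_xsection; rewrite -[X in measurable X]setTI.
  exact: measurable_consp.
apply/funext => x /=; congr (lebtuple _).
by apply/seteqP; split => t; rewrite /xsection /= inE.
Qed.

(** * Behaviour of the measure under dilations *)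

Lemma measurable_mulr (R : realType) (s : R) :
  measurable_fun setT (fun x : measurableTypeR R => s * x : measurableTypeR R).
Proof. exact: measurable_funM. Qed.

(** As a function of A, the right-hand side is s times the image of Lebesgue measure under
    multiplication by s. It is a measure with the right values on half-open intervals, so uniqueness
    applies. *)
Lemma lebesgue_measure_scale (R : realType) (s : R) (A : set (measurableTypeR R)) :
  0 < s -> measurable A ->
  lebesgue_measure A = (s%:E * lebesgue_measure [set x : R | A (s * x)%R])%E.
Proof.
move=> s0 mA.
pose f : measurableTypeR R -> measurableTypeR R := fun x => s * x.
have mf : measurable_fun setT f by exact: measurable_mulr.
pose H := isMeasurableFun.Build _ _ _ _ _ mf.
pose F : {mfun measurableTypeR R >-> measurableTypeR R} := HB.pack f H.
have -> : (s%:E * lebesgue_measure [set x : R | A (s * x)%R] =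
  mscale (NngNum (ltW s0)) (pushforward (@lebesgue_measure R) F) A)%E by [].
apply: lebesgue_measure_unique => //= _ [[a b]] _ <-.
rewrite /mscale /pushforward /=.
rewrite [X in (_ * lebesgue_measure X)%E](_ : _ = `]s^-1 * a, s^-1 * b]%classic);
  last first.
  by apply/seteqP; split => x /=; rewrite !in_itv/= /f ltr_pdivrMl// ler_pdivlMl.
rewrite !lebesgue_measure_itv /= !lte_fin ltr_pM2l ?invr_gt0//.
case: ifP => _; last by rewrite mule0.
by rewrite -!EFinB -EFinM -mulrBr mulrA divff ?mul1r // gt_eqF.
Qed.

Lemma ge0_integral_scale (R : realType) (s : R) (f : measurableTypeR R -> \bar R) :
  0 < s -> measurable_fun setT f -> (forall x, 0 <= f x)%E ->
  (\int[@lebesgue_measure R]_x f x =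
   s%:E * \int[@lebesgue_measure R]_x f (s * x)%R)%E.
Proof.
move=> s0 mf f0.
pose g : measurableTypeR R -> measurableTypeR R := fun x => s * x.
have mg : measurable_fun setT g by exact: measurable_mulr.
pose H := isMeasurableFun.Build _ _ _ _ _ mg.
pose G : {mfun measurableTypeR R >-> measurableTypeR R} := HB.pack g H.
rewrite (_ : (\int[@lebesgue_measure R]_x f x =
    \int[mscale (NngNum (ltW s0)) (pushforward (@lebesgue_measure R) G)]_x f x)%E);
  last first.
  by apply: eq_measure_integral => A mA _; exact: lebesgue_measure_scale.
by rewrite ge0_integral_mscale//= ge0_integral_pushforward.
Qed.

Lemma measurable_tscale (R : realType) (n : nat) (s : R) :
  measurable_fun setT (fun t : mtuple R n =>
    [tuple s * tnth t i | i < n] : mtuple R n).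
Proof.
apply/measurable_fun_tnthP => i.
rewrite (_ : _ \o _ = (fun x : measurableTypeR R => s * x : measurableTypeR R) \o
    (@tnth _ _ ^~ i)); last by apply/funext => t /=; rewrite tnth_mktuple.
apply: measurableT_comp; [exact: measurable_mulr|exact: measurable_tnth].
Qed.

(** Induction on n by slicing along the first coordinate: the substitution in the outer integral
    yields one factor s, and the induction hypothesis on the slices yields the other n. *)
Lemma lebtuple_scale (R : realType) (n : nat) (s : R)
    (A : set (mtuple R n)) :
  0 < s -> measurable A ->
  lebtuple A = ((s ^+ n)%:E * lebtuple
    [set t : mtuple R n | A [tuple (s * tnth t i)%R | i < n]])%E.
Proof.
move=> s0; elim: n A => [|n IH] A mA.
  rewrite expr0 mul1e; congr (lebtuple _); apply/seteqP; split => t /=;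
    by rewrite ?(tuple0 t) ?(tuple0 (mktuple _)) ?(tuple0 [tuple]).
have mA' : measurable (@consp (measurableTypeR R) n @^-1` A).
  rewrite -[X in measurable X]setTI; exact: measurable_consp.
have mAs : measurable [set t : mtuple R n.+1 |
    A [tuple s * tnth t i | i < n.+1]].
  by rewrite -[X in measurable X]setTI; apply: measurable_tscale.
rewrite !lebtupleS (@ge0_integral_scale _ s)//; last exact: measurable_lebtuple_section.
rewrite exprS EFinM -muleA; congr (_ * _)%E.
rewrite -ge0_integralZl//; last 2 first.
- exact: (measurable_lebtuple_section mAs).
- by rewrite lee_fin exprn_ge0// ltW.
apply: eq_integral => x _; rewrite IH; last first.
  rewrite (_ : mkset _ = xsection (@consp (measurableTypeR R) n @^-1` A) (s * x)).
    exact: measurable_xsection.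
  by apply/seteqP; split => t; rewrite /xsection /= inE.
congr (_ * lebtuple _)%E; apply/seteqP; split => t /=;
  rewrite (_ : consp (s * x, [tuple s * tnth t i | i < n]) =
    [tuple s * tnth (consp (x, t)) i | i < n.+1])//;
  apply: eq_from_tnth => i; rewrite tnth_mktuple;
  by have [j ->|->] := unliftP ord0 i; rewrite ?tnth0// !tnthS tnth_mktuple.
Qed.

(** * Hyperplanes are null sets *)

Definition colt (R : realType) (n : nat) (t : n.-tuple R) : 'cV[R]_n :=
  \col_i tnth t i.

Lemma measurable_dotp_colt (R : realType) (n : nat) (v : 'cV[R]_n) :
  measurable_fun [set: mtuple R n]
    ((fun t => dotp v (colt t)) : mtuple R n -> R).
Proof.
apply: measurable_sum => i; apply: measurable_funM; first exact: measurable_cst.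
rewrite (_ : (fun _ => _) = @tnth _ (measurableTypeR R) ^~ i).
  exact: measurable_tnth.
by apply/funext => t; rewrite mxE.
Qed.

Lemma dotp_consp (R : realType) (n : nat) (v : 'cV[R]_n.+1) (x : R)
    (t : n.-tuple R) :
  dotp v (colt (consp (x, t))) =
  v ord0 0 * x + dotp (\col_i v (lift ord0 i) 0) (colt t).
Proof.
rewrite /dotp big_ord_recl mxE tnth0; congr (_ + _).
by apply: eq_bigr => i _; rewrite !mxE tnthS.
Qed.

Lemma dot0p (R : realType) (n : nat) (x : 'cV[R]_n) : dotp 0 x = 0.
Proof. by rewrite /dotp big1// => i _; rewrite mxE mul0r. Qed.

Lemma measurable_hyperplane_colt (R : realType) (n : nat) (v : 'cV[R]_n) (c : R) :
  measurable [set t : mtuple R n | dotp v (colt t) = c].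
Proof.
rewrite -[X in measurable X]setTI.
exact: (@measurable_dotp_colt R n v measurableT [set c] (measurable_set1 c)).
Qed.

(** Slice along the first coordinate and let v' be v without its first entry. If v' is nonzero,
    every slice is a hyperplane and is null by induction. Otherwise the first entry of v is nonzero
    and only one slice is nonempty. *)
Lemma lebtuple_hyperplane (R : realType) (n : nat) (v : 'cV[R]_n) (c : R) :
  v != 0 ->
  lebtuple [set t : mtuple R n | dotp v (colt t) = c] = 0%E.
Proof.
elim: n v c => [|n IH] v c v0; first by rewrite flatmx0 eqxx in v0.
have mH := measurable_hyperplane_colt v c.
rewrite lebtupleS.
pose v' : 'cV[R]_n := \col_i v (lift ord0 i) 0.
have sE x :
    [set t : mtuple R n | dotp v (colt (consp (x, t))) = c] =
    [set t | dotp v' (colt t) = c - v ord0 0 * x].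
  by apply/seteqP; split => t /=; rewrite dotp_consp -/v' => h; lra.
have [v'0|v'0] := eqVneq v' 0; last first.
  by rewrite integral0_eq// => x _; rewrite sE IH.
have v00 : v ord0 0 != 0.
  apply: contra_neq v0 => v00; apply/matrixP => i j; rewrite ord1 [RHS]mxE.
  have [k ->|->//] := unliftP ord0 i.
  by have /matrixP/(_ k 0) := v'0; rewrite !mxE.
rewrite (ge0_ae_eq_integral (g := cst 0%E)) ?integral0//; last 2 first.
- exact: (measurable_lebtuple_section mH).
(* For v' = 0 the slice at x is empty unless x is the solution of [v ord0 0 * x = c]. *)
- exists [set c / v ord0 0]; split => //; first exact: lebesgue_measure_set1.
  move=> x /= /not_implyP[_ fx]; apply: contra_notP fx => xc.
  rewrite sE (_ : mkset _ = set0) ?lebtuple0//.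
  rewrite -subset0 => t /=; rewrite v'0 dot0p => /esym/eqP.
  rewrite subr_eq0 => /eqP cE.
  by apply: xc; rewrite cE mulrAC divff// mul1r.
Qed.

(** * Volumes of polyhedra: scaling, finiteness, continuity *)

Definition polyt (R : realType) (n m : nat) (V : 'M[R]_(n, m)) (c : 'cV[R]_m) :
    set (mtuple R n) :=
  [set t | polyhedron V c (colt t)].

Lemma vol_polyhedron (R : realType) (n m : nat) (V : 'M[R]_(n, m)) (c : 'cV[R]_m) :
  vol (polyhedron V c) = lebtuple (polyt V c).
Proof. by []. Qed.

Lemma measurable_polyt (R : realType) (n m : nat) (V : 'M[R]_(n, m)) (c : 'cV[R]_m) :
  measurable (polyt V c).
Proof.
rewrite (_ : polyt V c = \bigcap_(j in [set: 'I_m])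
  ((fun t : mtuple R n => dotp (col j V) (colt t)) @^-1`
     `]-oo, c j 0]%classic)).
  apply: fin_bigcap_measurable => // j _.
  rewrite -[X in measurable X]setTI; apply: measurable_dotp_colt => //.
by apply/seteqP; split => t /= h i => [_|]; [have := h i|have := h i Logic.I];
  rewrite /= in_itv/=.
Qed.

Lemma vol_polyhedron_scale (R : realType) (n m : nat) (V : 'M[R]_(n, m))
    (c : 'cV[R]_m) (s : R) : 0 < s ->
  vol (polyhedron V (s *: c)) = ((s ^+ n)%:E * vol (polyhedron V c))%E.
Proof.
move=> s0; rewrite !vol_polyhedron (lebtuple_scale s0); last exact: measurable_polyt.
have sE v t : dotp v (colt [tuple s * tnth t i | i < n]) = s * dotp v (colt t).
  rewrite /dotp mulr_sumr; apply: eq_bigr => i _.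
  by rewrite !mxE tnth_mktuple mulrCA.
congr (_ * lebtuple _)%E; apply/seteqP.
by split => t /= h j; have := h j; rewrite sE mxE ler_pM2l.
Qed.

Lemma dotp_mulmx (R : realType) (n m : nat) (V : 'M[R]_(n, m)) (l : 'cV[R]_m) x :
  dotp (V *m l) x = \sum_j l j 0 * dotp (col j V) x.
Proof.
rewrite /dotp; under eq_bigr do rewrite mxE mulr_suml.
rewrite exchange_big; apply: eq_bigr => j _ /=; rewrite mulr_sumr.
by apply: eq_bigr => i _; rewrite mxE; ring.
Qed.

Lemma dotp_delta (R : realType) (n : nat) (a : R) (i : 'I_n) (x : 'cV[R]_n) :
  dotp (a *: delta_mx i 0) x = a * x i 0.
Proof.
rewrite /dotp (bigD1 i)//= big1 ?addr0 ?mxE ?eqxx ?mulr1// => k ki.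
by rewrite !mxE (negPf ki) mulr0 mul0r.
Qed.

(** Writing e_i and - e_i as non-negative combinations of the columns bounds x_i from both sides.
    The box depends on M only, so one box dominates all polyhedra of a sequence with bounded
    right-hand sides. *)
Lemma polyhedron_bounded (R : realType) (n m : nat) (V : 'M[R]_(n, m)) (M : R) :
  pos V = setT -> 0 <= M ->
  exists B : 'I_n -> R, (forall i, 0 <= B i) /\
    forall c : 'cV[R]_m, (forall j, c j 0 <= M) ->
    forall x, polyhedron V c x -> forall i, - B i <= x i 0 <= B i.
Proof.
move=> posV M0.
have bound (a : R) (i : 'I_n) : exists K : R, 0 <= K /\
    forall c : 'cV[R]_m, (forall j, c j 0 <= M) ->
    forall x, polyhedron V c x -> a * x i 0 <= K.
  have : pos V (a *: delta_mx i 0) by rewrite posV.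
  move=> [l [l0 lE]]; exists (\sum_j l j 0 * M); split.
    by rewrite sumr_ge0// => j _; rewrite mulr_ge0.
  move=> c cM x xP; rewrite -dotp_delta lE dotp_mulmx ler_sum// => j _.
  by rewrite ler_wpM2l// (le_trans (xP j)).
have [K KP] := choice (bound 1); have [L LP] := choice (bound (-1)).
(* K bounds x_i and L bounds - x_i; both are non-negative, so their sum bounds the absolute
   value. *)
exists (fun i => K i + L i); split=> [i|c cM x xP i].
  by rewrite addr_ge0 ?(KP i).1 ?(LP i).1.
have := (KP i).2 c cM x xP; have := (LP i).2 c cM x xP.
have := (KP i).1; have := (LP i).1; lra.
Qed.

Lemma vol_polyhedron_fin_num (R : realType) (n m : nat) (V : 'M[R]_(n, m))
    (c : 'cV[R]_m) : pos V = setT -> vol (polyhedron V c) \is a fin_num.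
Proof.
move=> posV; pose M := \sum_j `|c j 0|.
have M0 : 0 <= M by rewrite sumr_ge0.
have [B [B0 BP]] := polyhedron_bounded posV M0.
have cM j : c j 0 <= M.
  by rewrite (le_trans (ler_norm _))// /M (bigD1 j)//= lerDl sumr_ge0.
rewrite ge0_fin_numE; last exact: (lebtuple_ge0 (polyt V c)).
apply: (@le_lt_trans _ _ (lebtuple [set t | forall i, - B i <= tnth t i <= B i])).
  rewrite vol_polyhedron le_measure ?inE//.
  - exact: measurable_polyt.
  - exact: measurable_tbox.
  - by move=> t /(BP c cM) h i; have := h i; rewrite mxE.
rewrite [X in (X < _)%E](@lebesgueT_box R n (fun i => - B i) B) ?ltry// => i.
by rewrite (le_trans _ (B0 i))// oppr_le0.
Qed.

(** Dominated convergence for the indicators of the polyhedra, which converge at every point off the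
    limiting hyperplanes of the nonzero columns. A zero column gives the constraint [0 <= c k j 0],
    which the second alternative makes true for every k. *)
Lemma vol_polyhedron_cvg (R : realType) (n m : nat) (V : 'M[R]_(n, m))
    (c : nat -> 'cV[R]_m) (l : 'cV[R]_m) : pos V = setT ->
  (forall j, col j V != 0 \/ forall k, 0 <= c k j 0) ->
  (forall j, c k j 0 @[k --> \oo] --> l j 0) ->
  fine (vol (polyhedron V (c k))) @[k --> \oo] --> fine (vol (polyhedron V l)).
Proof.
move=> posV colV cl; apply: fine_cvg.
rewrite fineK; last exact: vol_polyhedron_fin_num.
have /choice[K KP] : forall j, exists M, forall k, `|c k j 0| <= M.
  move=> j; have /cvgP/cvg_seq_bounded[M [_ MP]] := cl j.
  by exists (M + 1) => k; apply: MP; rewrite ?ltrDl.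
pose M := \sum_j `|K j|.
have M0 : 0 <= M by rewrite sumr_ge0.
have cM k j : c k j 0 <= M.
  rewrite (le_trans (ler_norm _))// (le_trans (KP j k))// (le_trans (ler_norm _))//.
  by rewrite /M (bigD1 j)//= lerDl sumr_ge0.
have [B [B0 BP]] := polyhedron_bounded posV M0.
pose box := [set t : mtuple R n |
  forall i, - B i <= tnth t i <= B i].
have mbox : measurable box by exact: measurable_tbox.
have volE a : vol (polyhedron V a) =
    (\int[@lebtuple R n]_x (\1_(polyt V a) x)%:E)%E.
  by rewrite integral_indic// ?setIT//; exact: measurable_polyt.
rewrite volE; under eq_fun do rewrite volE.
have mi a : measurable_fun setT (fun x => (\1_(polyt V a) x)%:E : \bar R).
  by apply/measurable_EFinP; apply: measurable_indic; exact: measurable_polyt.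
have ae_cvg : {ae @lebtuple R n, forall x, setT x ->
    ((\1_(polyt V (c k)) x)%:E : \bar R) @[k --> \oo] -->
    ((\1_(polyt V l) x)%:E : \bar R)}.
  have ae_filter := ae_filter_ringOfSetsType (@lebtuple R n).
  have : {ae @lebtuple R n, forall x, forall j, col j V != 0 ->
      dotp (col j V) (colt x) <> l j 0}.
    apply: (@filter_forall _ _ _ _ ae_filter) => j.
    have [->|vj] := eqVneq (col j V) 0; first by apply: nearW.
    exists [set t | dotp (col j V) (colt t) = l j 0]; split.
    + exact: measurable_hyperplane_colt.
    + exact: lebtuple_hyperplane.
    + by move=> t /= /not_implyP[_ /contrapT].
  apply: (@filterS _ _ ae_filter) => x xl _; apply: cvg_near_cst.
  (* Off the hyperplanes, the limit constraints with nonzero normal that hold at x hold strictly, so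
     they hold for all large k. A violated limit constraint is strict anyway, so it stays
     violated. *)
  have [xP|xP] := pselect (polyt V l x).
    have : \forall k \near \oo, forall j, dotp (col j V) (colt x) <= c k j 0.
      apply: filter_forall => j; have [vj|] := eqVneq (col j V) 0.
        have [|cj] := colV j; first by rewrite vj eqxx.
        by apply: nearW => k; rewrite vj dot0p.
      move=> /xl/eqP ne; apply: (cvgr_ge _ (cl j)).
      by rewrite lt_neqAle ne xP.
    apply: filterS => k kP; rewrite !indicE !mem_set//.
  have /existsNP[j /negP] := xP; rewrite -ltNge => lj.
  have : \forall k \near \oo, c k j 0 < dotp (col j V) (colt x).
    exact: (cvgr_lt _ (cl j)).
  apply: filterS => k kP; rewrite !indicE !memNset//.
  by move=> /(_ j); apply/negP; rewrite -ltNge.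
have int_box : (@lebtuple R n).-integrable setT (fun x => (\1_box x)%:E).
  apply/integrableP; split; first exact/measurable_EFinP/measurable_indic.
  rewrite (eq_integral (fun x => (\1_box x)%:E)); last first.
    by move=> x _; rewrite gee0_abs.
  rewrite integral_indic// setIT.
  rewrite [X in (X < _)%E](@lebesgueT_box R n (fun i => - B i) B) ?ltry// => i.
  by rewrite (le_trans _ (B0 i))// oppr_le0.
have dom : {ae @lebtuple R n, forall x k, setT x ->
    (`|(\1_(polyt V (c k)) x)%:E| <= ((\1_box x)%:E : \bar R))%E}.
  apply: nearW => x k _; rewrite lee_fin !indicE.
  have [xP|_] := boolP (x \in polyt V (c k)); last by rewrite normr0 ler0n.
  rewrite mem_set ?normr1//= => i; move: xP; rewrite inE => /(BP _ (cM k))/(_ i).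
  by rewrite mxE.
by have [_ _] := dominated_convergence measurableT (fun k => mi (c k)) (mi l)
  ae_cvg int_box dom.
Qed.

(** Sequential continuity suffices for a function of a real variable; dominated convergence is a
    statement about sequences. *)
Lemma continuous_vol_polyhedron (R : realType) (n m : nat) (V : 'M[R]_(n, m))
    (c : R -> 'cV[R]_m) : pos V = setT ->
  (forall j, col j V != 0 \/ forall t, 0 <= c t j 0) ->
  (forall j, continuous (fun t => c t j 0)) ->
  continuous (fun t => fine (vol (polyhedron V (c t)))).
Proof.
move=> posV colV cc t; apply/(@cvg_nbhsP _ R^o) => u ut.
apply: (@vol_polyhedron_cvg _ _ _ V (fun k => c (u k))) => //.
  by move=> j; have [|cj] := colV j; [left|right].
by move=> j; exact: (cvg_comp _ _ ut (cc j t)).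
Qed.

(** * Inner products and orthonormal frames *)

Lemma dotpE (R : realType) (n : nat) (x y : 'cV[R]_n) : dotp x y = (x^T *m y) 0 0.
Proof. by rewrite mxE; apply: eq_bigr => i _; rewrite mxE. Qed.

Lemma dotpDr (R : realType) (n : nat) (x y z : 'cV[R]_n) :
  dotp x (y + z) = dotp x y + dotp x z.
Proof. by rewrite !dotpE mulmxDr mxE. Qed.

Lemma dotpZr (R : realType) (n : nat) (a : R) (x y : 'cV[R]_n) :
  dotp x (a *: y) = a * dotp x y.
Proof. by rewrite !dotpE -scalemxAr mxE. Qed.

Lemma dotp_trmx (R : realType) (n k : nat) (B : 'M[R]_(n, k)) x y :
  dotp x (B *m y) = dotp (B^T *m x) y.
Proof. by rewrite !dotpE trmx_mul trmxK mulmxA. Qed.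

Lemma dotpC (R : realType) (n : nat) (x y : 'cV[R]_n) : dotp x y = dotp y x.
Proof. by apply: eq_bigr => i _; rewrite mulrC. Qed.

Lemma dotp_ge0 (R : realType) (n : nat) (x : 'cV[R]_n) : 0 <= dotp x x.
Proof. by apply: sumr_ge0 => i _; rewrite -expr2 sqr_ge0. Qed.

Lemma enorm1_dotp (R : realType) (n : nat) (x : 'cV[R]_n) :
  enorm x = 1 -> dotp x x = 1.
Proof.
by move=> x1; rewrite -(sqr_sqrtr (dotp_ge0 x)) [Num.sqrt _]x1 expr1n.
Qed.

(** The equality [n = k] is a hypothesis because the matrix of interest, a unit vector next to its
    frame, has format n by [1 + n.-1]. *)
Lemma orthonormal_tr (R : realType) (n k : nat) (Q : 'M[R]_(n, k)) :
  n = k -> Q^T *m Q = 1%:M -> Q *m Q^T = 1%:M.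
Proof. by move=> nk; case: _ / nk Q => Q /mulmx1C. Qed.

Lemma frame_orthonormal (R : realType) (n : nat) (u : 'cV[R]_n) :
  (0 < n)%N -> enorm u = 1 -> (frame u)^T *m frame u = 1%:M.
Proof. by move=> n0 u1; have [] := frameP n0 u1. Qed.

Lemma frame_orthogonal (R : realType) (n : nat) (u : 'cV[R]_n) :
  (0 < n)%N -> enorm u = 1 -> (frame u)^T *m u = 0.
Proof.
move=> n0 u1; have [_ /(congr1 trmx)] := frameP n0 u1.
by rewrite trmx_mul trmxK trmx0.
Qed.

(** The vector u and its frame form an orthogonal matrix Q. Expanding v as Q Q^T v leaves only the
    component along u. *)
Lemma frame_decomposition (R : realType) (n : nat) (u v : 'cV[R]_n) :
  (0 < n)%N -> enorm u = 1 -> (frame u)^T *m v = 0 -> v = dotp u v *: u.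
Proof.
move=> n0 u1 Bv.
have nE : n = (1 + n.-1)%N by rewrite add1n prednK.
pose Q : 'M[R]_(n, 1 + n.-1) := row_mx u (frame u).
have QQ : Q^T *m Q = 1%:M.
  rewrite tr_row_mx mul_col_row frame_orthonormal// frame_orthogonal//.
  have -> : u^T *m frame u = 0 by have [] := frameP n0 u1.
  rewrite [u^T *m u]mx11_scalar -dotpE enorm1_dotp//.
  by rewrite [RHS]scalar_mx_block.
have QQ' := orthonormal_tr nE QQ.
rewrite -[LHS]mul1mx -QQ' tr_row_mx mul_row_col mulmxDl -!mulmxA Bv mulmx0 addr0.
by rewrite [u^T *m v]mx11_scalar -dotpE mul_mx_scalar.
Qed.

Lemma col_mulmx (R : realType) (n m k : nat) (A : 'M[R]_(k, n))
    (V : 'M[R]_(n, m)) j :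
  col j (A *m V) = A *m col j V.
Proof. by rewrite !colE mulmxA. Qed.

(** * Faces in frame coordinates and continuity of the cone-volume vector *)

Definition face_rhs (R : realType) (n m : nat) (U : 'M[R]_(n, m)) (b : 'cV[R]_m)
    (i : 'I_m) : 'cV[R]_m :=
  \col_j (b j 0 - b i 0 * dotp (col i U) (col j U)).

(** Substituting x = b_i u_i + B y in each constraint moves the constant term to the right-hand
    side. The equation of the hyperplane holds for every y, since u_i is a unit vector orthogonal to
    the columns of B. *)
Lemma hvol_face (R : realType) (n m : nat) (U : 'M[R]_(n, m)) (b : 'cV[R]_m)
    (i : 'I_m) : (0 < n)%N -> enorm (col i U) = 1 ->
  hvol (col i U) (b i 0) (face U b i) =
  vol (polyhedron ((frame (col i U))^T *m U) (face_rhs U b i)).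
Proof.
move=> n0 ui1; congr vol; apply/seteqP.
have dE j y : dotp (col j U) (b i 0 *: col i U + frame (col i U) *m y) =
    b i 0 * dotp (col i U) (col j U) + dotp (col j ((frame (col i U))^T *m U)) y.
  by rewrite dotpDr dotpZr dotp_trmx col_mulmx dotpC.
split => y /=.
  by move=> [yP _] j; have := yP j; rewrite dE mxE lerBrDl.
move=> yP; split=> [j|]; first by have := yP j; rewrite dE mxE lerBrDl.
rewrite /hyperplane /= dE col_mulmx frame_orthogonal// dot0p addr0.
by rewrite enorm1_dotp// mulr1.
Qed.

(** The transposed frame is a left inverse of the frame, so it carries a non-negative combination
    representing [frame u *m y] to one representing y. *)
Lemma pos_frame (R : realType) (n m : nat) (U : 'M[R]_(n, m)) (u : 'cV[R]_n) :
  (0 < n)%N -> enorm u = 1 -> pos U = setT -> pos ((frame u)^T *m U) = setT.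
Proof.
move=> n0 u1 posU; rewrite -subTset => y _.
have : pos U (frame u *m y) by rewrite posU.
move=> [l [l0 lE]]; exists l; split => //.
by rewrite -mulmxA -lE mulmxA frame_orthonormal// mul1mx.
Qed.

Lemma face_rhs_ge0 (R : realType) (n m : nat) (U : 'M[R]_(n, m)) (b : 'cV[R]_m)
    (i j : 'I_m) : (0 < n)%N -> inU U -> (forall k, 0 <= b k 0) ->
  col j ((frame (col i U))^T *m U) = 0 -> 0 <= face_rhs U b i j 0.
Proof.
move=> n0 [U1 injU _] b0; rewrite col_mulmx => /(frame_decomposition n0 (U1 i)) jE.
(* By [jE], u_j is the multiple of u_i by k, the inner product of u_i and u_j. Both are unit
   vectors, so k is 1 or -1; the case k = 1 forces j = i by injectivity. *)
have : dotp (col i U) (col j U) ^+ 2 = 1.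
  rewrite -(enorm1_dotp (U1 j)) {3}jE dotpZr [dotp (col j U) _]dotpC.
  by rewrite expr2.
move/eqP; rewrite sqrf_eq1 => /orP[] /eqP kE; rewrite mxE kE; last first.
  by rewrite mulrN1 opprK addr_ge0.
by move: jE; rewrite kE scale1r => /injU ->; rewrite mulr1 subrr.
Qed.

Lemma continuous_hvol_face (R : realType) (n m : nat) (U : 'M[R]_(n, m))
    (c : R -> 'cV[R]_m) (i : 'I_m) : (0 < n)%N -> inU U ->
  (forall t j, 0 <= c t j 0) -> (forall j, continuous (fun t => c t j 0)) ->
  continuous (fun t => fine (hvol (col i U) (c t i 0) (face U (c t) i))).
Proof.
move=> n0 UU c0 cc; have [U1 _ posU] := UU.
under eq_fun do rewrite hvol_face//.
apply: continuous_vol_polyhedron; first exact: pos_frame.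
  move=> j; have [vj|] := eqVneq (col j ((frame (col i U))^T *m U)) 0; last by left.
  by right => t; apply: face_rhs_ge0.
move=> j; under eq_fun do rewrite mxE.
move=> t; apply: cvgB; first exact: cc.
by apply: cvgM; [exact: cc|exact: cvg_cst].
Qed.

Lemma continuous_cV (R : realType) (m : nat) (f : R -> 'cV[R]_m) :
  (forall j, continuous (fun t => f t j 0)) -> continuous f.
Proof.
move=> cf t; apply/cvg_ballP => e e0.
have : \forall x \near t, forall j, ball (f t j 0) e (f x j 0).
  apply: (@filter_forall _ _ _ _ (nbhs_filter t)) => j; exact: (cvg_ball (cf j t)).
by apply: filterS => x fx; split=> // j k; rewrite ord1; exact: fx.
Qed.

Lemma continuous_cone_volume (R : realType) (n m : nat) (U : 'M[R]_(n, m))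
    (c : R -> 'cV[R]_m) : (0 < n)%N -> inU U ->
  (forall t j, 0 <= c t j 0) -> (forall j, continuous (fun t => c t j 0)) ->
  continuous (fun t => cone_volume U (c t)).
Proof.
move=> n0 UU c0 cc; apply: continuous_cV => i; under eq_fun do rewrite mxE.
move=> t; apply: cvgM; first exact: cvg_cst.
by apply: cvgM; [exact: cc|exact: continuous_hvol_face].
Qed.

(** * Positive volume along the segment, and the rescaled path *)

Lemma vol_polyhedron_mono (R : realType) (n m : nat) (V : 'M[R]_(n, m))
    (b c : 'cV[R]_m) : (forall j, b j 0 <= c j 0) ->
  (vol (polyhedron V b) <= vol (polyhedron V c))%E.
Proof.
move=> bc; rewrite !vol_polyhedron le_measure ?inE//; [exact: measurable_polyt..|].
by move=> t tb j; exact: le_trans (tb j) (bc j).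
Qed.

(** Since t c is non-negative, the polyhedron contains the one for (1 - t) b, a dilate of P(V, b)
    with positive factor when t < 1. At t = 1 it is P(V, c). *)
Lemma vol_convex_gt0 (R : realType) (n m : nat) (V : 'M[R]_(n, m))
    (b c : 'cV[R]_m) (t : R) : (forall j, 0 <= b j 0) -> (forall j, 0 <= c j 0) ->
  (0 < vol (polyhedron V b))%E -> (0 < vol (polyhedron V c))%E -> 0 <= t <= 1 ->
  (0 < vol (polyhedron V ((1 - t) *: b + t *: c)))%E.
Proof.
move=> b0 c0 vb vc /andP[t0 t1].
have [->|tn1] := eqVneq t 1; first by rewrite subrr scale0r add0r scale1r.
have t'0 : 0 < 1 - t by rewrite subr_gt0 lt_neqAle tn1.
apply: (@lt_le_trans _ _ (vol (polyhedron V ((1 - t) *: b)))).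
  by rewrite vol_polyhedron_scale// mule_gt0// lte_fin exprn_gt0.
by apply: vol_polyhedron_mono => j; rewrite !mxE lerDl mulr_ge0.
Qed.

Lemma continuous_powR (R : realType) (a : R) (f : R -> R) :
  continuous f -> (forall t, 0 < f t) -> continuous (fun t => f t `^ a).
Proof.
move=> cf f0 t.
have -> : (fun t => f t `^ a) = expR \o (fun t => a * ln (f t)).
  by apply/funext => x; rewrite /powR gt_eqF//.
apply: continuous_comp; last exact: continuous_expR.
apply: cvgM; first exact: cvg_cst.
exact: (cvg_comp _ _ (cf t) (continuous_ln (f0 t))).
Qed.

Theorem proposition2p10 (R : realType) (n m : nat) (hn : (0 < n)%N)
    (U : 'M[R]_(n, m)) (hU : inU U) :
  path_connected R (cone_volume_set U).
Proof.
move=> _ _ [b [b0 vb ->]] [b' [b'0 vb' ->]]; have [U1 _ posU] := hU.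
(* Clamping the parameter to [0, 1] keeps the right-hand sides non-negative for every real t, as the
   continuity lemmas require. *)
pose clamp (t : R) := Num.max 0 (Num.min 1 t).
have clampP t : 0 <= clamp t <= 1.
  by rewrite /clamp le_max lexx ge_max ler01 ge_min lexx.
have clamp_cont : continuous clamp.
  move=> t; apply: continuous_max; first exact: cvg_cst.
  by apply: continuous_min; [exact: cvg_cst|exact: cvg_id].
pose d t := (1 - clamp t) *: b + clamp t *: b'.
have d0 t j : 0 <= d t j 0.
  have /andP[? ?] := clampP t.
  by rewrite !mxE addr_ge0// mulr_ge0// subr_ge0.
have d_cont j : continuous (fun t => d t j 0).
  under eq_fun do rewrite !mxE.
  move=> t; apply: cvgD; apply: cvgM; try exact: cvg_cst; last exact: clamp_cont.
  by apply: cvgB; [exact: cvg_cst|exact: clamp_cont].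
pose w t := fine (vol (polyhedron U (d t))).
have wE t : vol (polyhedron U (d t)) = (w t)%:E.
  by rewrite fineK// vol_polyhedron_fin_num.
have w0 t : 0 < w t.
  by rewrite -lte_fin -wE vol_convex_gt0// ?vb ?vb'.
have w_cont : continuous w.
  apply: continuous_vol_polyhedron => // j; left.
  apply/eqP => uj; have := enorm1_dotp (U1 j); rewrite uj dot0p => /eqP.
  by rewrite eq_sym oner_eq0.
(* Volume is homogeneous of degree n, so dilation by w^(-1/n) brings volume w to 1. *)
pose s t := w t `^ (- n%:R^-1).
have s0 t : 0 < s t by exact: powR_gt0.
have s_cont : continuous s by exact: continuous_powR.
have sw t : s t ^+ n * w t = 1.
  rewrite -powR_mulrn ?ltW// /s -powRrM mulNr mulVf ?pnatr_eq0 -?lt0n//.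
  by rewrite powR_inv1 ?ltW// mulVf// gt_eqF.
have c0 t j : 0 <= (s t *: d t) j 0 by rewrite mxE mulr_ge0// ltW.
(* At both ends the volume is already 1, so the rescaled path starts exactly at b and ends exactly
   at b'. *)
have c1 t : w t = 1 -> s t *: d t = d t by move=> w1; rewrite /s w1 powR1 scale1r.
exists (fun t => cone_volume U (s t *: d t)); split.
- apply: continuous_subspaceT; apply: continuous_cone_volume => // j.
  under eq_fun do rewrite mxE.
  by move=> t; apply: cvgM; [exact: s_cont|exact: d_cont].
- have dE : d 0 = b.
    by rewrite /d /clamp (min_r ler01) maxxx subr0 scale1r scale0r addr0.
  by rewrite c1 ?dE// /w dE vb.
- have dE : d 1 = b'.
    by rewrite /d /clamp minxx (max_r ler01) subrr scale1r scale0r add0r.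
  by rewrite c1 ?dE// /w dE vb'.
- move=> t _; exists (s t *: d t); split => //.
  by rewrite vol_polyhedron_scale// wE -EFinM sw.
Qed.
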